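(* Let $\mathcal{C}$ be a nondegenerate $[n,k,d]_{q^m/q}$ rank-metric code. For $0\le i\le n$ let $A_i^{\mathrm{rk}}(\mathcal{C})$ be the number of codewords of $\mathcal{C}$ of rank $i$, and let $\mathcal{C}^{\mathrm{H}}$ be any Hamming-metric code associated with $\mathcal{C}$. For every integer $j$ with $0\le j\le \frac{q^n-1}{q-1}$, the number $A_j^{\mathrm{H}}(\mathcal{C}^{\mathrm{H}})$ of codewords of $\mathcal{C}^{\mathrm{H}}$ of Hamming weight $j$ is $$A_j^{\mathrm{H}}(\mathcal{C}^{\mathrm{H}})=\begin{cases}A_i^{\mathrm{rk}}(\mathcal{C}) & \text{if } j=\frac{q^n-q^{n-i}}{q-1} \text{ for some } 0\le i\le n,\\ 0 & \text{otherwise.}\end{cases}$$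
   Context: Let $q$ be a prime power and $n,m,k$ positive integers. For $v\in\mathbb{F}_{q^m}^n$ and an ordered basis $\Gamma=(\gamma_1,\dots,\gamma_m)$ of $\mathbb{F}_{q^m}$ over $\mathbb{F}_q$, let $\Gamma(v)\in\mathbb{F}_q^{n\times m}$ be the matrix with $v_i=\sum_{j}\Gamma(v)_{ij}\gamma_j$. The rank support $\sigma^{\mathrm{rk}}(v)\subseteq\mathbb{F}_q^n$ is the column space of $\Gamma(v)$ (independent of $\Gamma$), and $\mathrm{rk}(v)=\dim_{\mathbb{F}_q}\sigma^{\mathrm{rk}}(v)$. An $[n,k,d]_{q^m/q}$ code is a $k$-dimensional $\mathbb{F}_{q^m}$-subspace $\mathcal{C}\subseteq\mathbb{F}_{q^m}^n$ with minimum rank of a nonzero codeword equal to $d$; it is nondegenerate if $\sum_{v\in\mathcal{C}}\sigma^{\mathrm{rk}}(v)=\mathbb{F}_q^n$. Associated Hamming-metric code. Let $\mathcal{C}$ be a nondegenerate $[n,k]_{q^m/q}$ code, let $G\in\mathbb{F}_{q^m}^{k\times n}$ be a generator matrix (its rows form a basis of $\mathcal{C}$) and let $\mathcal{U}\subseteq\mathbb{F}_{q^m}^k$ be the $\mathbb{F}_q$-span of the columns of $G$. For a point $P=\langle w\rangle_{\mathbb{F}_{q^m}}$ of $\mathrm{PG}(k-1,q^m)$ set $\mathrm{wt}_{\mathcal{U}}(P)=\dim_{\mathbb{F}_q}(\mathcal{U}\cap\langle w\rangle_{\mathbb{F}_{q^m}})$ and $\mathrm{m}_{\mathcal{U}}(P)=\frac{q^{\mathrm{wt}_{\mathcal{U}}(P)}-1}{q-1}$.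 One has $\sum_P \mathrm{m}_{\mathcal{U}}(P)=\frac{q^n-1}{q-1}$. Let $G_{\mathrm{Ext}}$ be a $k\times\frac{q^n-1}{q-1}$ matrix over $\mathbb{F}_{q^m}$ whose columns are, in some order, nonzero representative vectors of the points $P$, each point $P$ being represented by exactly $\mathrm{m}_{\mathcal{U}}(P)$ columns. A Hamming-metric code associated with $\mathcal{C}$, denoted $\mathcal{C}^{\mathrm{H}}$, is any code of length $\frac{q^n-1}{q-1}$ over $\mathbb{F}_{q^m}$ that is monomially equivalent to (i.e. the image under an $\mathbb{F}_{q^m}$-linear Hamming isometry of) the row space of $G_{\mathrm{Ext}}$; up to monomial equivalence it does not depend on the choices made. *)

(* Defs.v *)
From HB Require Import structures.
From mathcomp Require Import all_boot all_order all_algebra all_field.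

Set Implicit Arguments.
Unset Strict Implicit.
Unset Printing Implicit Defensive.

Import GRing.Theory.
Local Open Scope ring_scope.

(* F plays the role of F_q with q = #|F|, and L that of F_{q^m} with
   m = \dim {:L}.  [finvect_type L] is L itself, carrying in addition its
   canonical finFieldType structure, so that vectors over it can be counted. *)

(* The division is exact: this is 1 + q + ... + q^(r-1). *)
Definition pg_size (F : finFieldType) (r : nat) : nat :=
  ((#|F| ^ r - 1) %/ (#|F| - 1))%N.

Section RankMetric.

Variables (F : finFieldType) (L : fieldExtType F) (n m : nat).
Local Notation Lf := (finvect_type L).
Variable Gamma : m.-tuple Lf.

Definition expand_mx (v : 'rV[Lf]_n) : 'M[F]_(n, m) :=
  \matrix_(i, j) coord Gamma j (v ord0 i).

Definition rank_support (v : 'rV[Lf]_n) : {vspace 'cV[F]_n} :=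
  <<[seq col j (expand_mx v) | j : 'I_m]>>%VS.

Definition rank_weight (v : 'rV[Lf]_n) : nat := \dim (rank_support v).

Definition is_min_rank_distance (C : {vspace 'rV[Lf]_n}) (d : nat) : Prop :=
  (exists v, [/\ v \in C, v != 0 & rank_weight v = d]) /\
  (forall v, v \in C -> v != 0 -> (d <= rank_weight v)%N).

Definition rank_code (C : {vspace 'rV[Lf]_n}) (k d : nat) : Prop :=
  \dim C = k /\ is_min_rank_distance C d.

Definition rank_nondegenerate (C : {vspace 'rV[Lf]_n}) : Prop :=
  (\sum_(v : 'rV[Lf]_n | v \in C) rank_support v)%VS = fullv.

Definition rank_weight_count (C : {vspace 'rV[Lf]_n}) (i : nat) : nat :=
  #|[set v : 'rV[Lf]_n | (v \in C) && (rank_weight v == i)]|.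

End RankMetric.

Section HammingMetric.

Variables (K : finFieldType) (N : nat).

Definition hamming_weight (v : 'rV[K]_N) : nat := #|[set i | v ord0 i != 0]|.

Definition hamming_weight_count (D : {vspace 'rV[K]_N}) (j : nat) : nat :=
  #|[set v : 'rV[K]_N | (v \in D) && (hamming_weight v == j)]|.

Definition monomially_equivalent (D D' : {vspace 'rV[K]_N}) : Prop :=
  exists phi : 'End('rV[K]_N),
    (forall v, hamming_weight (phi v) = hamming_weight v) /\
    D' = (phi @: D)%VS.

End HammingMetric.

Section AssociatedCode.

Variables (F : finFieldType) (L : fieldExtType F) (n k : nat).
Local Notation Lf := (finvect_type L).

Definition row_code (N : nat) (G : 'M[Lf]_(k, N)) : {vspace 'rV[Lf]_N} :=
  <<[seq row i G | i : 'I_k]>>%VS.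

Definition generator_matrix (C : {vspace 'rV[Lf]_n}) (G : 'M[Lf]_(k, n)) : Prop :=
  basis_of C [seq row i G | i : 'I_k].

(* MathComp's vector space structure on 'cV[Lf]_k is the one over Lf; finite
   functions to Lf carry the structure over F. *)
Definition to_ffun (w : 'cV[Lf]_k) : {ffun 'I_k -> Lf} :=
  [ffun i => w i ord0].

(* An Lf-subspace regarded as an F-subspace; see [mem_restrict_scalars]. *)
Definition restrict_scalars (P : {vspace 'cV[Lf]_k}) :
    {vspace {ffun 'I_k -> Lf}} :=
  <<[seq to_ffun w | w : 'cV[Lf]_k in P]>>%VS.

Lemma mem_restrict_scalars (P : {vspace 'cV[Lf]_k}) (w : 'cV[Lf]_k) :
  (to_ffun w \in restrict_scalars P) = (w \in P).
Proof.
apply/idP/idP => [|Pw]; last first.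
  by apply: memv_span; apply/imageP; exists w.
move=> /(@coord_span _ _ _ (in_tuple _)) /= E.
have ->: w = \sum_i (coord (in_tuple [seq to_ffun w | w : 'cV[Lf]_k in P]) i
   (to_ffun w))%:A *: (\col_l ([seq to_ffun w | w : 'cV[Lf]_k in P]`_i l)).
  apply/colP => l; move/ffunP/(_ l): E; rewrite ffunE => ->.
  rewrite sum_ffunE summxE; apply: eq_bigr => i _.
  by rewrite !ffunE !mxE mulr_algl.
apply: memv_suml => i _; apply: memvZ.
have /imageP[u Pu ->] := mem_nth 0 (ltn_ord i).
by congr (_ \in P): Pu; apply/colP => l; rewrite !mxE ffunE.
Qed.

Definition column_system (G : 'M[Lf]_(k, n)) : {vspace {ffun 'I_k -> Lf}} :=
  <<[seq to_ffun (col j G) | j : 'I_n]>>%VS.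

Definition point_weight (U : {vspace {ffun 'I_k -> Lf}})
    (P : {vspace 'cV[Lf]_k}) : nat :=
  \dim (U :&: restrict_scalars P).

Definition point_mult (U : {vspace {ffun 'I_k -> Lf}})
    (P : {vspace 'cV[Lf]_k}) : nat :=
  pg_size F (point_weight U P).

(* The points of PG(k - 1, q^m) are the P with \dim P = 1. *)
Definition ext_matrix (G : 'M[Lf]_(k, n)) (GE : 'M[Lf]_(k, pg_size F n)) : Prop :=
  (forall j, col j GE != 0) /\
  (forall P : {vspace 'cV[Lf]_k}, \dim P = 1%N ->
     #|[set j | <[col j GE]>%VS == P]| = point_mult (column_system G) P).

Definition associated_code (C : {vspace 'rV[Lf]_n})
    (CH : {vspace 'rV[Lf]_(pg_size F n)}) : Prop :=
  exists (G : 'M[Lf]_(k, n)) (GE : 'M[Lf]_(k, pg_size F n)),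
    [/\ generator_matrix C G, ext_matrix G GE &
        monomially_equivalent (row_code GE) CH].

End AssociatedCode.

(* Main.v *)
(* The codeword xG of C corresponds to the codeword xGE of the extended code.
   A coordinate of xGE vanishes exactly when its point lies in the hyperplane
   x^perp, so the number of zeros, times q - 1, is the number of nonzero vectors
   of the system U in x^perp.  Nondegeneracy identifies U with F_q^n through
   u |-> Gu, and xGu = 0 exactly when u is in the left kernel of the expansion
   of xG; this leaves q^(n - rk(xG)) - 1 vectors, hence Hamming weight
   (q^n - q^(n - rk(xG))) / (q - 1). *)
Require Import Defs.
From mathcomp Require Import all_boot all_order all_algebra all_field.
From mathcomp Require Import mxabelem zify.

Set Implicit Arguments.
Unset Strict Implicit.
Unset Printing Implicit Defensive.
Import GRing.Theory.
Local Open Scope ring_scope.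

(** * Spans, ranks and kernels by counting *)

Lemma memv_span_imageP (K : fieldType) (vT : vectType K) (I : finType)
    (f : I -> vT) (v : vT) :
  reflect (exists c : I -> K, v = \sum_i c i *: f i)
          (v \in <<[seq f i | i : I]>>%VS).
Proof.
rewrite span_def big_image; apply: (iffP memv_sumP) => [[vs vsP ->]|[c ->]].
  have /fin_all_exists[c cP] i : exists a, vs i = a *: f i.
    by apply/vlineP/vsP.
  by exists c; apply: eq_bigr.
by exists (fun i => c i *: f i) => // i _; rewrite memvZ ?memv_line.
Qed.

Lemma col_mulmx (R : nzSemiRingType) m n p (A : 'M[R]_(m, n)) (B : 'M[R]_(n, p)) j :
  col j (A *m B) = A *m col j B.
Proof. by apply/colP => i; rewrite !mxE; apply: eq_bigr => l _; rewrite mxE. Qed.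

Lemma pg_size_mul (F : finFieldType) r :
  (pg_size F r * (#|F| - 1) = #|F| ^ r - 1)%N.
Proof. by rewrite /pg_size divnK // !subn1 predn_exp dvdn_mulr. Qed.

(** Over a finite field the dimension can be read off the cardinality: transposition maps the span
    of the columns bijectively onto the row space of [A^T]. *)
Lemma dim_col_span (F : finFieldType) n m (A : 'M[F]_(n, m)) :
  \dim <<[seq col j A | j : 'I_m]>>%VS = \rank A.
Proof.
apply: (expnI (finNzRing_gt1 F)).
rewrite -card_vspace -mxrank_tr -card_rowg -(card_imset _ (@trmx_inj F n 1)).
apply: eq_card => u; rewrite mem_rowg.
apply/imsetP/submxP => [[v /memv_span_imageP[c ->] ->]|[D Du]].
  exists (\row_j c j); rewrite mulmx_sum_row linear_sum; apply: eq_bigr => i _.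
  by rewrite linearZ /= tr_col mxE.
exists u^T; last by rewrite trmxK.
apply/memv_span_imageP; exists (D 0).
rewrite Du trmx_mul trmxK; apply/colP => i; rewrite mxE summxE.
by apply: eq_bigr => j _; rewrite !mxE mulrC.
Qed.

Lemma rank_weightE (F : finFieldType) (L : fieldExtType F) n m
    (Gamma : m.-tuple (finvect_type L)) (v : 'rV[finvect_type L]_n) :
  rank_weight Gamma v = \rank (expand_mx Gamma v).
Proof. exact: dim_col_span. Qed.

Lemma card_left_kernel (F : finFieldType) n m (A : 'M[F]_(n, m)) :
  #|[set u : 'rV[F]_n | u *m A == 0]| = (#|F| ^ (n - \rank A))%N.
Proof.
rewrite -mxrank_ker -card_rowg; apply: eq_card => u.
by rewrite mem_rowg inE; apply/eqP/sub_kermxP.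
Qed.

(** * The system [U] as an injective image of [F^n] *)

Section Systems.
Variables (F : finFieldType) (L : fieldExtType F) (n k : nat).
Local Notation Lf := (finvect_type L).

Definition scalars_mx (u : 'rV[F]_n) : 'cV[Lf]_n := \col_i (u 0 i)%:A.

Lemma expand_mxK m (Gamma : m.-tuple Lf) (v : 'rV[Lf]_n) i :
  basis_of fullv Gamma -> v 0 i = \sum_j expand_mx Gamma v i j *: Gamma`_j.
Proof.
move=> GammaB; rewrite {1}(coord_basis GammaB (memvf (v 0 i))).
by apply: eq_bigr => j _; rewrite mxE.
Qed.

(** The entries of [u *m expand_mx Gamma v] are the coordinates in [Gamma] of the single entry of
    [v *m scalars_mx u], and [Gamma] is free. *)
Lemma mulmx_scalars_eq0 m (Gamma : m.-tuple Lf) (v : 'rV[Lf]_n) (u : 'rV[F]_n) :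
  basis_of fullv Gamma ->
  (v *m scalars_mx u == 0) = (u *m expand_mx Gamma v == 0).
Proof.
move=> GammaB.
have /freeP fG : free Gamma by apply: basis_free GammaB.
have E : (v *m scalars_mx u) 0 0 = \sum_j (u *m expand_mx Gamma v) 0 j *: Gamma`_j.
  rewrite mxE.
  under [RHS]eq_bigr => j _ do rewrite mxE scaler_suml.
  rewrite exchange_big; apply: eq_bigr => i _ /=.
  rewrite mxE mulrC mulr_algl (expand_mxK _ _ GammaB) scaler_sumr.
  by apply: eq_bigr => j _; rewrite scalerA.
apply/eqP/eqP => [e0|e0].
  move: E; rewrite e0 mxE => /esym /fG z.
  by apply/rowP => j; rewrite z mxE.
apply/matrixP => i j; rewrite !ord1 E e0 mxE.
by apply: big1 => l _; rewrite mxE scale0r.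
Qed.

Lemma memv_column_system (G : 'M[Lf]_(k, n)) (w : 'cV[Lf]_k) :
  reflect (exists u, w = G *m scalars_mx u) (to_ffun w \in column_system G).
Proof.
have E (c : 'I_n -> F) : \sum_j c j *: to_ffun (col j G)
    = to_ffun (G *m scalars_mx (\row_j c j)).
  apply/ffunP => i; rewrite sum_ffunE !ffunE mxE; apply: eq_bigr => j _.
  by rewrite !ffunE !mxE mulrC mulr_algl.
apply: (iffP (memv_span_imageP _ _)) => [[c]|[u ->]].
  rewrite E => /ffunP cE; exists (\row_j c j); apply/colP => i.
  by have := cE i; rewrite !ffunE.
exists (u 0); rewrite E; congr (to_ffun (_ *m scalars_mx _)).
by apply/rowP => i; rewrite mxE.
Qed.

(** If [G] kills [u], so does every codeword, since it is a combination of rows of [G]. Hence [u]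
    annihilates all rank supports, which together span [F^n]. *)
Lemma rank_nondegenerate_inj m (Gamma : m.-tuple Lf) (C : {vspace 'rV[Lf]_n})
    (G : 'M[Lf]_(k, n)) :
  basis_of fullv Gamma -> rank_nondegenerate Gamma C -> generator_matrix C G ->
  injective (fun u => G *m scalars_mx u).
Proof.
move=> GammaB Cnd GC u1 u2 /= e.
pose u := u1 - u2.
have scB : scalars_mx u = scalars_mx u1 - scalars_mx u2.
  by apply/colP => i; rewrite !mxE scalerBl.
have Gu0 : G *m scalars_mx u = 0 by rewrite scB mulmxBr e subrr.
have full_ker : (fullv <= lker (linfun (mulmx u : 'cV[F]_n -> 'cV[F]_1)))%VS.
  rewrite -Cnd; apply/subv_sumP => v; rewrite -(span_basis GC).
  move=> /memv_span_imageP[c vc]; apply/span_subvP => _ /imageP[j _ ->].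
  have : v *m scalars_mx u == 0.
    rewrite vc mulmx_suml; apply/eqP; apply: big1 => i _.
    by rewrite -scalemxAl -row_mul Gu0 row0 scaler0.
  rewrite (mulmx_scalars_eq0 _ _ GammaB) => /eqP u0.
  by rewrite memv_ker lfunE /= -col_mulmx u0; apply/eqP/colP => i; rewrite !mxE.
apply/eqP; rewrite -subr_eq0; apply/eqP/rowP => i; rewrite -/u mxE.
(* Evaluating the zero functional at a unit vector reads off an entry of [u]. *)
have /(subvP full_ker) : delta_mx i 0 \in (fullv : {vspace 'cV[F]_n}) by exact: memvf.
rewrite memv_ker lfunE /= -colE => /eqP/matrixP/(_ 0 0).
by rewrite !mxE.
Qed.

Lemma card_column_system_hyperplane m (Gamma : m.-tuple Lf)
    (C : {vspace 'rV[Lf]_n}) (G : 'M[Lf]_(k, n)) (x : 'rV[Lf]_k) :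
  basis_of fullv Gamma -> rank_nondegenerate Gamma C -> generator_matrix C G ->
  #|[set w : 'cV[Lf]_k | (to_ffun w \in column_system G) && (x *m w == 0)]|
    = (#|F| ^ (n - rank_weight Gamma (x *m G)))%N.
Proof.
move=> GammaB Cnd GC.
rewrite rank_weightE -card_left_kernel.
rewrite -(card_imset _ (rank_nondegenerate_inj GammaB Cnd GC)).
apply: eq_card => w; rewrite inE; apply/andP/imsetP => [[/memv_column_system[u ->]]|[u]].
  by rewrite mulmxA (mulmx_scalars_eq0 _ _ GammaB) => ux; exists u; rewrite ?inE.
rewrite inE -(mulmx_scalars_eq0 _ _ GammaB) => ux ->.
by rewrite mulmxA; split=> //; apply/memv_column_system; exists u.
Qed.

(** * Points, their multiplicities and the zeros of an extended codeword *)

Lemma vline_eqE (K : fieldType) (vT : vectType K) (u v : vT) :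
  u != 0 -> v != 0 -> (<[u]>%VS == <[v]>%VS) = (u \in <[v]>%VS).
Proof.
move=> u0 v0; apply/eqP/idP => [<-|uv]; first exact: memv_line.
by apply/eqP; rewrite eqEdim -memvE uv !dim_vline u0 v0.
Qed.

Lemma card_point (u : 'cV[Lf]_k) : u != 0 ->
  #|[set w : 'cV[Lf]_k | (w != 0) && (<[w]>%VS == <[u]>%VS)]| = (#|Lf| - 1)%N.
Proof.
move=> u0; have := card_vspace (<[u]> : {vspace 'cV[Lf]_k})%VS.
rewrite dim_vline u0 expn1 => <-.
rewrite (cardD1 0 (mem <[u]>%VS)) mem0v add1n subn1 /=.
apply: eq_card => w; rewrite !inE; case: eqVneq => //= w0.
by rewrite vline_eqE.
Qed.

Lemma to_ffun_inj : injective (@to_ffun F L k).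
Proof. by move=> x y /ffunP xy; apply/colP => i; have := xy i; rewrite !ffunE. Qed.

Lemma to_ffun0 : to_ffun (0 : 'cV[Lf]_k) = 0.
Proof. by apply/ffunP => i; rewrite !ffunE mxE. Qed.

(** Both sides count the nonzero vectors of [U] on the point: such a vector lies on the line of [u]
    exactly when it spans it. *)
Lemma point_mult_mul (U : {vspace {ffun 'I_k -> Lf}}) (u : 'cV[Lf]_k) : u != 0 ->
  (point_mult U <[u]>%VS * (#|F| - 1))%N =
  #|[set w : 'cV[Lf]_k | [&& w != 0, to_ffun w \in U & <[u]>%VS == <[w]>%VS]]|.
Proof.
move=> u0; rewrite pg_size_mul.
rewrite -card_vspace (cardD1 (0 : {ffun _})).
rewrite mem0v add1n subn1 /= -(card_imset _ to_ffun_inj).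
apply: eq_card => f; pose w : 'cV[Lf]_k := \col_i f i.
have -> : f = to_ffun w by apply/ffunP => i; rewrite ffunE mxE.
rewrite (mem_imset _ _ to_ffun_inj) !inE.
rewrite -to_ffun0 (inj_eq to_ffun_inj) memv_cap mem_restrict_scalars.
by case: eqVneq => //= w0; rewrite eq_sym vline_eqE.
Qed.

Lemma card_ext_hyperplane (G : 'M[Lf]_(k, n)) (GE : 'M[Lf]_(k, pg_size F n))
    (x : 'rV[Lf]_k) :
  ext_matrix G GE ->
  (#|[set j | x *m col j GE == 0%R]| * (#|F| - 1) =
   #|[set w : 'cV[Lf]_k | (to_ffun w \in column_system G) && (x *m w == 0%R)]| - 1)%N.
Proof.
move=> [GE0 GEm].
have Lgt1 : (0 < #|Lf| - 1)%N by rewrite subn_gt0 finNzRing_gt1.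
have x_line (u v : 'cV[Lf]_k) : <[u]>%VS == <[v]>%VS -> x *m u == 0 -> x *m v == 0.
  move=> /eqP uv /eqP xu; have : v \in <[u]>%VS by rewrite uv memv_line.
  by move=> /vlineP[a ->]; rewrite -scalemxAr xu scaler0.
(* Scaling by the number of nonzero vectors on a point turns sums over points
   into sums over vectors. *)
apply/eqP; rewrite -(eqn_pmul2r Lgt1); apply/eqP.
set H := [set w : 'cV[Lf]_k | (w != 0) && (x *m w == 0)].
set W := [set w in H | to_ffun w \in column_system G].
(* First double count: each column orthogonal to [x] is paired with the [#|Lf| - 1] vectors spanning
   its point, all of which lie in [H]. *)
transitivity (\sum_(w in H) #|[set j | <[col j GE]>%VS == <[w]>%VS]| * (#|F| - 1))%N.
  rewrite -big_distrl /= mulnAC; congr (_ * _)%N.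
  rewrite -sum_nat_const.
  under [RHS]eq_bigr => w _ do rewrite -sum1dep_card.
  rewrite (exchange_big_dep (fun j => x *m col j GE == 0)) /=; last first.
    by move=> w j; rewrite inE => /andP[_ xw]; rewrite eq_sym => /x_line; apply.
  rewrite [LHS](eq_bigl (fun j => x *m col j GE == 0)) => [|j]; last by rewrite inE.
  apply: eq_bigr => j xj; rewrite -(card_point (GE0 j)) -sum1dep_card.
  apply: eq_bigl => w; rewrite inE [<[col j GE]>%VS == _]eq_sym.
  case: (boolP (<[w]>%VS == _)) => [wj|]; rewrite ?andbF // !andbT.
  by rewrite (x_line (col j GE) w) ?andbT // eq_sym.
(* The multiplicity condition on [GE] trades the columns on the point of [w], times [#|F| - 1], for
   the nonzero vectors of the system on that point. *)
transitivity (\sum_(w in H) #|[set u in W | <[w]>%VS == <[u]>%VS]|)%N.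
  apply: eq_bigr => w; rewrite inE => /andP[w0 xw].
  rewrite GEm ?dim_vline ?w0 // point_mult_mul //; apply: eq_card => u.
  rewrite !inE; case: (eqVneq u 0) => //= u0.
  case: (boolP (<[w]>%VS == <[u]>%VS)) => wu; rewrite ?andbF ?andbT //.
  by rewrite (x_line _ _ wu xw).
under eq_bigr => w _ do rewrite -sum1dep_card.
rewrite (exchange_big_dep (fun u => u \in W)) /=; last by move=> w u _ /andP[].
(* Second double count: each [u] in [W] is met once for every [w] spanning its point, so the
   auxiliary factor reappears and cancels. *)
transitivity (\sum_(u in W) (#|Lf| - 1))%N.
  apply: eq_bigr => u uW; move: uW; rewrite !inE => /andP[/andP[u0 xu] Uu].
  rewrite -(card_point u0) -sum1dep_card; apply: eq_bigl => w.
  rewrite !inE u0 xu Uu /=; case: (boolP (<[w]>%VS == _)) => [wu|]; rewrite ?andbF ?andbT //.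
  by rewrite (x_line u w) ?andbT // eq_sym.
rewrite sum_nat_const; congr (_ * _)%N.
(* The subtracted 1 is the zero vector, which lies in the system and in the hyperplane but not in
   [W]. *)
rewrite [in RHS](cardD1 0) inE to_ffun0 mem0v mulmx0 eqxx add1n subn1 /=.
by apply: eq_card => w; rewrite !inE; case: eqVneq => //= _; rewrite andbC.
Qed.

Lemma hamming_weight_ext m (Gamma : m.-tuple Lf)
    (C : {vspace 'rV[Lf]_n}) (G : 'M[Lf]_(k, n)) (GE : 'M[Lf]_(k, pg_size F n))
    (x : 'rV[Lf]_k) :
  basis_of fullv Gamma -> rank_nondegenerate Gamma C -> generator_matrix C G ->
  ext_matrix G GE ->
  (hamming_weight (x *m GE) * (#|F| - 1) =
   #|F| ^ n - #|F| ^ (n - rank_weight Gamma (x *m G)))%N.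
Proof.
move=> GammaB Cnd GC GEG.
have := card_ext_hyperplane x GEG.
rewrite (card_column_system_hyperplane x GammaB Cnd GC).
have -> : [set j | x *m col j GE == 0] = ~: [set j | (x *m GE) 0 j != 0].
  apply/setP => j; rewrite !inE negbK -col_mulmx.
  by apply/eqP/eqP => [/matrixP/(_ 0 0)|xj]; [|apply/matrixP => a b];
    rewrite ?ord1 !mxE // -[RHS]xj mxE.
have := cardsC [set j | (x *m GE) 0 j != 0]; rewrite card_ord -/(hamming_weight _).
move: (hamming_weight _) => h; set z := #|_| => hz zE.
(* Positivity makes the truncated subtractions of 1 exact in the final arithmetic. *)
have q0 r : (0 < #|F| ^ r)%N by rewrite expn_gt0 ltnW ?finNzRing_gt1.
have := pg_size_mul F n; rewrite -hz mulnDl zE => e.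
have := q0 n; have := q0 (n - rank_weight Gamma (x *m G))%N.
by move: e; move: (_ * _)%N (#|F| ^ (n - _))%N (#|F| ^ n)%N; lia.
Qed.

(** * Transfer from messages to codewords of both codes *)

Lemma hamming_weight_eq0 (K : finFieldType) N (v : 'rV[K]_N) :
  (hamming_weight v == 0%N) = (v == 0).
Proof.
rewrite cards_eq0; apply/eqP/eqP => [/setP v0|->].
  by apply/rowP => i; have := v0 i; rewrite !inE mxE => /negbFE/eqP.
by apply/setP => i; rewrite !inE mxE eqxx.
Qed.

Lemma memv_row_span (K : fieldType) N (G : 'M[K]_(k, N)) v :
  reflect (exists x, v = x *m G) (v \in <<[seq row i G | i : 'I_k]>>%VS).
Proof.
apply: (iffP (memv_span_imageP _ _)) => [[c ->]|[x ->]].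
  exists (\row_i c i); rewrite mulmx_sum_row; apply: eq_bigr => i _.
  by rewrite mxE.
by exists (x 0); rewrite mulmx_sum_row.
Qed.

(** The image of encoding is [C], which has [#|Lf| ^ k] elements, as many as there are messages. *)
Lemma generator_matrix_inj (C : {vspace 'rV[Lf]_n}) (G : 'M[Lf]_(k, n)) :
  generator_matrix C G -> injective (mulmx^~ G : 'rV_k -> 'rV_n).
Proof.
move=> GC.
suff /eqP/imset_injP injG : #|[set x *m G | x in [set: 'rV_k]]| = #|[set: 'rV[Lf]_k]|.
  by move=> x y; apply: injG; rewrite inE.
rewrite cardsT card_mx mul1n.
have dimC : \dim C = k.
  by rewrite -(span_basis GC) (eqP (basis_free GC)) size_image card_ord.
transitivity #|C|; last by rewrite card_vspace dimC.
apply: eq_card => v; rewrite -(span_basis GC).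
by apply/imsetP/memv_row_span => [[x _ ->]|[x ->]]; exists x.
Qed.

Lemma rank_weight_eq0 m (Gamma : m.-tuple Lf) (v : 'rV[Lf]_n) :
  basis_of fullv Gamma -> rank_weight Gamma v = 0%N -> v = 0.
Proof.
move=> GammaB; rewrite rank_weightE => /eqP; rewrite mxrank_eq0 => /eqP v0.
apply/rowP => i; rewrite (expand_mxK _ _ GammaB) v0 mxE.
by apply: big1 => j _; rewrite mxE scale0r.
Qed.

Lemma rank_weight_le m (Gamma : m.-tuple Lf) (v : 'rV[Lf]_n) :
  (rank_weight Gamma v <= n)%N.
Proof. by rewrite rank_weightE rank_leq_row. Qed.

End Systems.

(** The division is exact, so multiplying back loses nothing. The bound on [i] matters because
    [n - i] is truncated at 0 beyond it. *)
Lemma divn_expB_inj q n : (1 < q)%N ->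
  {in [pred i | (i <= n)%N] &,
     injective (fun i => (q ^ n - q ^ (n - i)) %/ (q - 1))%N}.
Proof.
move=> q1 i j; rewrite !inE => lein lejn /(congr1 (muln^~ (q - 1)%N)) /=.
have dvd l : (l <= n)%N -> (q - 1 %| q ^ n - q ^ (n - l))%N.
  move=> len; rewrite -{1}(subnK len) expnD -{2}(muln1 (q ^ (n - l))%N) -mulnBr.
  by rewrite !subn1 predn_exp dvdn_mull ?dvdn_mulr.
rewrite !divnK ?dvd // => e.
have leq l : (q ^ (n - l) <= q ^ n)%N by rewrite leq_exp2l ?leq_subr.
have /(expnI q1) : (q ^ (n - i) = q ^ (n - j))%N.
  by rewrite -(subKn (leq i)) e subKn.
lia.
Qed.

(** Both codes are parametrized injectively by messages, through [phi (x *m GE)] and [x *m G], and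
    the weight formula relates the two images of the same [x]. *)
Lemma card_associated_code (F : finFieldType) (L : fieldExtType F) (n m k : nat)
    (Gamma : m.-tuple (finvect_type L)) (C : {vspace 'rV[finvect_type L]_n})
    (CH : {vspace 'rV[finvect_type L]_(pg_size F n)}) (j : nat) :
  basis_of fullv Gamma -> rank_nondegenerate Gamma C -> associated_code k C CH ->
  hamming_weight_count CH j =
  #|[set v | (v \in C) &&
      ((#|F| ^ n - #|F| ^ (n - rank_weight Gamma v)) %/ (#|F| - 1) == j)%N]|.
Proof.
move=> GammaB Cnd [G [GE [GC GEG [phi [phiW ->]]]]].
have injG := generator_matrix_inj GC.
have q1 : (0 < #|F| - 1)%N by rewrite subn_gt0 finNzRing_gt1.
have wt x := hamming_weight_ext x GammaB Cnd GC GEG.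
(* Equal images give [x - y] an extended codeword of weight 0. The weight formula then forces rank
   0, so [x *m G] and [y *m G] agree. *)
have injH : injective (fun x => phi (x *m GE)).
  move=> x y /= /eqP; rewrite -subr_eq0 -linearB -mulmxBl -hamming_weight_eq0 phiW.
  move=> /eqP w0; have := wt (x - y); rewrite w0 mul0n => /esym/eqP.
  rewrite subn_eq0 leq_exp2l ?finNzRing_gt1 // => le_n.
  have /(rank_weight_eq0 GammaB) : rank_weight Gamma ((x - y) *m G) = 0%N.
    by have := rank_weight_le Gamma ((x - y) *m G); lia.
  by rewrite mulmxBl => /eqP; rewrite subr_eq0 => /eqP/injG.
transitivity #|[set x | hamming_weight (x *m GE) == j]|.
  rewrite -(card_imset _ injH); apply: eq_card => v; rewrite inE.
  apply/andP/imsetP => [[/memv_imgP[u /memv_row_span[x ->] ->]]|[x]].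
    by rewrite phiW => xj; exists x; rewrite ?inE.
  rewrite inE => xj ->; rewrite phiW; split=> //.
  by apply/memv_img/memv_row_span; exists x.
rewrite -(card_imset _ injG); apply: eq_card => v; rewrite inE -(span_basis GC).
apply/imsetP/andP => [[x]|[/memv_row_span[x ->]]].
  rewrite inE => xj ->; rewrite -wt mulnK //; split=> //.
  by apply/memv_row_span; exists x.
by rewrite -wt mulnK // => xj; exists x; rewrite ?inE.
Qed.

Theorem theorem4p8 (F : finFieldType) (L : fieldExtType F) (n m k d : nat)
    (n_gt0 : (0 < n)%N) (m_gt0 : (0 < m)%N) (k_gt0 : (0 < k)%N)
    (dimL : \dim {:L} = m)
    (Gamma : m.-tuple (finvect_type L))
    (Gamma_basis : basis_of fullv Gamma)
    (C : {vspace 'rV[finvect_type L]_n})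
    (C_code : rank_code Gamma C k d)
    (C_nondeg : rank_nondegenerate Gamma C)
    (CH : {vspace 'rV[finvect_type L]_(pg_size F n)})
    (CH_assoc : associated_code k C CH)
    (j : nat) (le_j : (j <= pg_size F n)%N) :
  (forall i : nat, (i <= n)%N ->
     j = ((#|F| ^ n - #|F| ^ (n - i)) %/ (#|F| - 1))%N ->
     hamming_weight_count CH j = rank_weight_count Gamma C i) /\
  ((forall i : nat, (i <= n)%N ->
     j <> ((#|F| ^ n - #|F| ^ (n - i)) %/ (#|F| - 1))%N) ->
     hamming_weight_count CH j = 0%N).
Proof.
rewrite (card_associated_code j Gamma_basis C_nondeg CH_assoc).
split=> [i lein ->|jP].
  apply: eq_card => v; rewrite !inE; congr (_ && _).
  apply/eqP/eqP => [/(divn_expB_inj (finNzRing_gt1 F))|-> //].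
  by apply; rewrite inE ?rank_weight_le.
(* A codeword counted here would make [j] the excluded value for [i] equal to its rank. *)
apply: eq_card0 => v; rewrite !inE; apply/andP => -[_ /eqP/esym].
exact: jP (rank_weight_le _ _).
Qed.
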